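(* Let $c\in\mathbb{N}$, let $k\in\mathbb{N}$, and let $S_1,\dots,S_k\subseteq\mathbb{N}$ satisfy $\overline{d}(S_i)>0$ for each $i=1,\dots,k$. Put $D_c=\bigcap_{i=1}^k\Delta_{2,c}(S_i)$. Then there is a set $S\subseteq\mathbb{N}$ with $d(S)>0$ and $\Delta_{1,c}(S)\subseteq D_c$. Furthermore, the set $D_c$ is syndetic.
   Context: $\mathbb{N}=\{1,2,3,\dots\}$. For $S\subseteq\mathbb{N}$, $\overline{d}(S)=\limsup_{N\to\infty}|S\cap\{1,\dots,N\}|/N$ and $\underline{d}(S)=\liminf_{N\to\infty}|S\cap\{1,\dots,N\}|/N$; if these are equal, the common value is denoted $d(S)$ (natural density). An assertion about $d(S)$ includes the assertion that it exists. For $S\subseteq\mathbb{N}$ and $m\in\mathbb{N}$, $S-m=\{j\in\mathbb{N}: j+m\in S\}$. $[\cdot]$ denotes the integral part. For $c>0$ and $S\subseteq\mathbb{N}$, $\Delta_{1,c}(S)=\{n\in\mathbb{N}: S\cap(S-[n^c])\ne\emptyset\}$ and $\Delta_{2,c}(S)=\{n\in\mathbb{N}:\overline{d}(S\cap(S-[n^c]))>0\}$. A set $C\subseteq\mathbb{N}$ is syndetic if there exist $m_1,\dots,m_\ell\in\mathbb{N}$ such that $\bigcup_{i=1}^\ell(C-m_i)=\mathbb{N}$. *)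

(* Defs.v *)
From HB Require Import structures.
From mathcomp Require Import all_boot all_order all_algebra.
From mathcomp Require Import finmap.
From mathcomp Require Import all_classical all_reals all_analysis.

Set Implicit Arguments.
Unset Strict Implicit.
Unset Printing Implicit Defensive.

Import Order.TTheory GRing.Theory Num.Theory.
Import numFieldNormedType.Exports.

Local Open Scope classical_set_scope.
Local Open Scope ring_scope.

(* The positive integers; a subset of them is an [S : set nat] with
   [S `<=` posnat]. *)
Definition posnat : set nat := [set n | (0 < n)%N].

(* The term at [N = 0] is [0 / 0 = 0]; it affects neither the limsup nor the
   liminf. *)
Definition density_seq (R : realType) (S : set nat) (N : nat) : R :=
  (#|` fset_set (S `&` [set n | (1 <= n <= N)%N])|)%fset%:R / N%:R.

Definition upper_density (R : realType) (S : set nat) : R :=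
  limn_sup (density_seq R S).

Definition lower_density (R : realType) (S : set nat) : R :=
  limn_inf (density_seq R S).

Definition has_density (R : realType) (S : set nat) (d : R) : Prop :=
  upper_density R S = d /\ lower_density R S = d.

Definition shift_set (S : set nat) (m : nat) : set nat :=
  posnat `&` [set j | S (j + m)%N].

Definition int_pow (R : realType) (c : R) (n : nat) : nat :=
  Num.truncn (n%:R `^ c).

Definition Delta1 (R : realType) (c : R) (S : set nat) : set nat :=
  posnat `&` [set n | S `&` shift_set S (int_pow c n) !=set0].

Definition Delta2 (R : realType) (c : R) (S : set nat) : set nat :=
  posnat `&`
  [set n | 0 < upper_density R (S `&` shift_set S (int_pow c n))].

Definition syndetic (C : set nat) : Prop :=
  exists2 s : seq nat, [set` s] `<=` posnat &
    \bigcup_(m in [set` s]) shift_set C m = posnat.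

(* Main.v *)
Require Import Defs.
From HB Require Import structures.
From mathcomp Require Import all_boot all_order all_algebra.
From mathcomp Require Import all_classical all_reals all_analysis.
From mathcomp Require Import finmap zify ring lra.

Import Order.TTheory GRing.Theory Num.Theory.
Import numFieldNormedType.Exports.

(** Write [h] for a difference and say that [h] is a dense return of a set when
    the set meets its shift by [h] in positive upper density.

    Existence of [S].  Every long interval contains a pattern of density bounded
    below whose differences are dense returns of all the [S_ i] at once
    ([dense_patterns_all]).  One adds the sets one at a time: delete from [S_ i]
    the points starting a difference which is not a dense return, a null set,
    and intersect the current pattern with a translate of what is left.  By
    averaging, some translate keeps a proportion given by the density of [S_ i].
    The sets with all differences in the common dense returns form a family that
    is closed and shift invariant.  Such a family contains a set having a natural
    density, equal to the largest density its members can have in long windows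
    ([extremal_natural_density]): no window of any member can beat the maximum by
    much, and some members attain it along all initial segments simultaneously.
    This replaces the passage to a measure preserving system followed by the
    pointwise ergodic theorem.

    Syndeticity.  Since [Delta1] of [S] lies in [D], it suffices that the [n]
    with [n ^ c] a difference of [S] form a syndetic set.  Otherwise [S] has no
    difference [n ^ c] for [n] in arbitrarily long windows.  The sets with no
    difference [b * n ^ c] in arbitrarily long windows of [n], for some [b > 0],
    form a class stable under restriction to arithmetic progressions and
    rescaling.  If some had positive upper Banach density, one whose density is
    nearly the supremum would have no density increment on progressions, so its
    balanced indicator would average to almost zero along every progression
    ([uniform_up_to_of_no_increment]).  Van der Corput differencing
    ([poly_correlation]) then makes its correlations along [b * n ^ c] small on
    average over every long window of [n], wherever it starts.  Yet on the
    avoided windows these correlations equal minus the square of the density.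

    Densities along windows are handled by shift-invariant means, obtained as
    limits of window averages along an ultrafilter, so that no boundary term
    appears in the estimates. *)

Set Implicit Arguments.
Unset Strict Implicit.
Unset Printing Implicit Defensive.

Local Open Scope classical_set_scope.
Local Open Scope ring_scope.

(** * Invariant means on bounded sequences *)

Definition window_avg (R : realType) (f : nat -> R) (x L : nat) : R :=
  (\sum_(i < L) f (x + i)%N) / L%:R.

Definition bounded_seq (R : realType) (f : nat -> R) : Prop :=
  exists C, forall x, `|f x| <= C.

Lemma bounded_seq_cst (R : realType) (c : R) : bounded_seq (fun=> c).
Proof. by exists `|c|. Qed.

Lemma bounded_seqD (R : realType) (f g : nat -> R) :
  bounded_seq f -> bounded_seq g -> bounded_seq (fun x => f x + g x).
Proof.
move=> [C fC] [D gD]; exists (C + D) => x.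
by rewrite (le_trans (ler_normD _ _)) ?lerD.
Qed.

Lemma bounded_seqM (R : realType) (f g : nat -> R) :
  bounded_seq f -> bounded_seq g -> bounded_seq (fun x => f x * g x).
Proof.
move=> [C fC] [D gD]; exists (C * D) => x.
by rewrite normrM ler_pM.
Qed.

Lemma bounded_seqN (R : realType) (f : nat -> R) :
  bounded_seq f -> bounded_seq (fun x => - f x).
Proof. by move=> [C fC]; exists C => x; rewrite normrN. Qed.

Lemma bounded_seq_norm (R : realType) (f : nat -> R) :
  bounded_seq f -> bounded_seq (fun x => `|f x|).
Proof. by move=> [C fC]; exists C => x; rewrite normr_id. Qed.

Lemma bounded_seq_comp (R : realType) (f : nat -> R) (s : nat -> nat) :
  bounded_seq f -> bounded_seq (fun x => f (s x)).
Proof. by move=> [C fC]; exists C => x. Qed.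

Lemma bounded_seq_sum (R : realType) (I : Type) (r : seq I) (f : I -> nat -> R) :
  (forall i, bounded_seq (f i)) -> bounded_seq (fun x => \sum_(i <- r) f i x).
Proof.
move=> fb; elim: r => [|i r IH].
  by exists 0 => x; rewrite big_nil normr0.
have [C hC] := bounded_seqD (fb i) IH.
by exists C => x; rewrite big_cons.
Qed.

Lemma bounded_seq_bool (R : realType) (A : pred nat) :
  bounded_seq (fun x => (A x)%:R : R).
Proof. by exists 1 => x; case: (A x); rewrite ?normr1 ?normr0. Qed.

Ltac solve_bounded := repeat first
  [ assumption
  | match goal with H : forall _, bounded_seq _ |- _ => exact: H end
  | apply: bounded_seq_bool | apply: bounded_seq_cst
  | apply: bounded_seq_norm | apply: bounded_seqD | apply: bounded_seqM | apply: bounded_seqN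
  | apply: bounded_seq_sum => ?
  | match goal with |- bounded_seq (fun x => ?f (@?s x)) =>
      apply: (@bounded_seq_comp _ f s) end ].

(** Only bounded sequences matter: the values of the mean elsewhere are junk,
    which is why linearity and monotonicity carry boundedness conditions. *)
Record invariant_mean (R : realType) (Lam : (nat -> R) -> R) : Prop :=
  InvariantMean {
    meanD : forall f g, bounded_seq f -> bounded_seq g ->
      Lam (fun x => f x + g x) = Lam f + Lam g;
    meanZ : forall a f, bounded_seq f -> Lam (fun x => a * f x) = a * Lam f;
    mean_cst : forall a, Lam (fun=> a) = a;
    mean_le : forall f g, bounded_seq f -> bounded_seq g ->
      (forall x, f x <= g x) -> Lam f <= Lam g;
    mean_succ : forall f, bounded_seq f -> Lam (fun x => f x.+1) = Lam f }.

Lemma window_avg_norm_le (R : realType) (f : nat -> R) (C : R) x L :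
  0 <= C -> (forall x, `|f x| <= C) -> `|window_avg f x L| <= C.
Proof.
move=> C0 fC; rewrite /window_avg normrM normfV normr_nat.
case: L => [|L]; first by rewrite invr0 mulr0.
rewrite ler_pdivrMr ?ltr0n// (le_trans (ler_norm_sum _ _ _))//.
apply: (@le_trans _ _ (\sum_(i < L.+1) C)); first exact: ler_sum.
by rewrite sumr_const card_ord mulr_natr.
Qed.

(** Unlike the image of the sets of a filter, the pushforward is an ultrafilter
    for maps that are not surjective: it decides each set through its preimage. *)
Lemma ultra_fmap (T V : Type) (f : T -> V) (F : set_system T) :
  UltraFilter F -> UltraFilter (f @ F).
Proof.
move=> UF; split; first exact: fmap_proper_filter.
move=> G PG FG; apply/seteqP; split; last exact: FG.
move=> A GA; have [//|FnA] := in_ultra_setVsetC (f @^-1` A) UF.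
have GnA : G (~` A) by apply: FG.
by have /filter_ex [? []] : G (A `&` (~` A)) by exact: filterI.
Qed.

(** The mean is the limit of the averages over the given windows along an
    ultrafilter finer than cofinite; the limit exists by compactness of segments,
    and the shift changes an average by two boundary terms over a length that
    tends to infinity. *)
Lemma exists_mean (R : realType) (x L : nat -> nat) :
  (forall j, (j < L j)%N) ->
  exists2 Lam : (nat -> R) -> R, invariant_mean Lam &
    forall f b, bounded_seq f ->
      (\forall j \near \oo, window_avg f (x j) (L j) <= b) -> Lam f <= b.
Proof.
move=> jL.
have [U [UU subU]] := @ultraFilterLemma nat (nbhs \oo) _.
pose a (f : nat -> R) j := window_avg f (x j) (L j).
have cvga f : bounded_seq f -> cvg (a f @ U).
  move=> [C fC].
  have C0 : 0 <= C by rewrite (le_trans _ (fC 0%N)).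
  have := @segment_compact R (- C) C; rewrite compact_ultra => /(_ (a f @ U)).
  have UI : UltraFilter (a f @ U) by exact: ultra_fmap.
  move=> /(_ UI) H.
  have : (a f @ U) `[- C, C]%classic.
    suff : U [set j | `[- C, C]%classic (a f j)] by [].
    by apply: filterE => j /=; rewrite in_itv /= -ler_norml; exact: window_avg_norm_le.
  by move=> /H [p [_ cp]]; apply/cvg_ex; exists p.
exists (fun f => lim (a f @ U)); last first.
  move=> f b /cvga cf H; apply: limr_le => //.
  exact: (subU _ H).
split.
- move=> f g bf bg; apply/cvg_lim => //.
  have -> : a (fun x => f x + g x) = (fun j => a f j + a g j).
    by apply/funext => j; rewrite /a /window_avg big_split mulrDl.
  by apply: cvgD; exact: cvga.
- move=> c f bf; apply/cvg_lim => //.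
  have -> : a (fun x => c * f x) = (fun j => c * a f j).
    by apply/funext => j; rewrite /a /window_avg -mulr_sumr mulrA.
  by apply: cvgM; [exact: cvg_cst | exact: cvga].
- move=> c; apply/cvg_lim => //.
  have -> : a (fun=> c) = fun=> c.
    apply/funext => j; rewrite /a /window_avg sumr_const card_ord -[_ *+ _]mulr_natr mulfK//.
    by rewrite pnatr_eq0 -lt0n (leq_ltn_trans _ (jL j)).
  exact: cvg_cst.
- move=> f g bf bg fg; apply: ler_lim; [exact: cvga|exact: cvga|].
  apply: filterE => j; rewrite /a /window_avg ler_pM2r ?invr_gt0 ?ltr0n; last first.
    by rewrite (leq_ltn_trans _ (jL j)).
  by apply: ler_sum.
- move=> f bf; apply/cvg_lim => //.
  have [C fC] := bf.
  (* The average of the shift minus the average telescopes to two end terms. *)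
  have -> : a (fun x => f x.+1) =
      (fun j => (f (x j + L j)%N - f (x j)) / (L j)%:R + a f j).
    apply/funext => j; rewrite /a /window_avg -mulrDl; congr (_ / _).
    rewrite addrAC; apply/eqP; rewrite eq_sym subr_eq; apply/eqP.
    rewrite addrC -(big_ord_recr (L j) (fun i => f (x j + i)%N)) /=.
    rewrite big_ord_recl addn0 addrC; congr (_ + _).
    by apply: eq_bigr => i _; rewrite addnS.
  rewrite -[X in _ --> X]add0r; apply: cvgD; last exact: cvga.
  suff H : (fun j => (f (x j + L j)%N - f (x j)) / (L j)%:R) @ \oo --> (0 : R).
    by move=> A /H /subU.
  apply/cvgr0Pnorm_le => /= e e0.
  exists (Num.truncn ((C + C) / e)).+1 => // j /= hj.
  have Lj : 0 < (L j)%:R :> R by rewrite ltr0n (leq_ltn_trans _ (jL j)).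
  rewrite normrM normfV normr_nat ler_pdivrMr//.
  apply: (@le_trans _ _ (C + C)).
    by rewrite (le_trans (ler_normB _ _))// lerD.
  rewrite -ler_pdivrMl// mulrC; apply: (le_trans (ltW (truncnS_gt _))).
  by rewrite ler_nat (leq_trans hj) // ltnW.
Qed.

Lemma mean_shift (R : realType) Lam (IM : @invariant_mean R Lam) h f :
  bounded_seq f -> Lam (fun x => f (x + h)%N) = Lam f.
Proof.
move=> bf; elim: h => [|h IH].
  by congr (Lam _); apply/funext => x; rewrite addn0.
rewrite -IH -(mean_succ IM (f := fun x => f (x + h)%N)); last by solve_bounded.
by congr (Lam _); apply/funext => x; rewrite addnS addSn.
Qed.

Lemma meanN (R : realType) Lam (IM : @invariant_mean R Lam) f :
  bounded_seq f -> Lam (fun x => - f x) = - Lam f.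
Proof.
move=> bf; rewrite -mulN1r -(meanZ IM)//.
by congr (Lam _); apply/funext => x; rewrite mulN1r.
Qed.

Lemma meanB (R : realType) Lam (IM : @invariant_mean R Lam) f g :
  bounded_seq f -> bounded_seq g -> Lam (fun x => f x - g x) = Lam f - Lam g.
Proof. by move=> bf bg; rewrite (meanD IM) ?(meanN IM)//; solve_bounded. Qed.

Lemma mean_sum (R : realType) Lam (IM : @invariant_mean R Lam) (I : Type)
    (r : seq I) (P : pred I) (f : I -> nat -> R) :
  (forall i, bounded_seq (f i)) ->
  Lam (fun x => \sum_(i <- r | P i) f i x) = \sum_(i <- r | P i) Lam (f i).
Proof.
move=> bf; elim: r => [|i r IH].
  rewrite big_nil -[RHS](mean_cst IM).
  by congr (Lam _); apply/funext => x; rewrite big_nil.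
rewrite big_cons; case: ifP => Pi; rewrite -IH.
  rewrite -(meanD IM)//; first by congr (Lam _); apply/funext => x; rewrite big_cons Pi.
  under eq_fun do rewrite big_mkcond /=.
  by apply: bounded_seq_sum => j; case: (P j) => //; solve_bounded.
by congr (Lam _); apply/funext => x; rewrite big_cons Pi.
Qed.

Lemma mean_norm (R : realType) Lam (IM : @invariant_mean R Lam) f :
  bounded_seq f -> `|Lam f| <= Lam (fun x => `|f x|).
Proof.
move=> bf; rewrite ler_norml -(meanN IM); last by solve_bounded.
apply/andP; split; apply: (mean_le IM); try by solve_bounded.
- by move=> x; rewrite lerNl -normrN ler_norm.
- by move=> x; rewrite ler_norm.
Qed.

(** * Extremal sets in shift-invariant closed families *)

Definition window_count (F : pred nat) (p n : nat) : nat := \sum_(i < n) F (p + i)%N.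

Lemma window_count_le F p n : (window_count F p n <= n)%N.
Proof.
rewrite -[X in (_ <= X)%N](card_ord n) -sum1_card; apply: leq_sum => i _.
by case: (F _).
Qed.

Lemma window_count_cat F p m n :
  window_count F p (m + n) =
  (window_count F p m + window_count F (p + m) n)%N.
Proof.
rewrite /window_count big_split_ord /=; congr (_ + _)%N.
by apply: eq_bigr => i _; rewrite addnA.
Qed.

Lemma window_count_avg (R : realType) F p n :
  (window_count F p n)%:R / n%:R = window_avg (fun x => (F x)%:R : R) p n.
Proof. by rewrite /window_avg /window_count natr_sum. Qed.

(** Cover the window greedily from its left end by the good windows; only the
    last, incomplete one costs, and it costs at most [N]. *)
Lemma window_count_cover (R : realType) (F : pred nat) (N : nat) (c : R) :
  (forall p, exists2 n, (0 < n <= N)%N & (window_count F p n)%:R <= c * n%:R) ->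
  forall L p, (window_count F p L)%:R <= c * L%:R + N%:R.
Proof.
move=> H.
have c0 : 0 <= c.
  have [n /andP[n0 _] cn] := H 0%N.
  by rewrite -(pmulr_lge0 c (x := n%:R)) ?ltr0n// (le_trans _ cn).
elim/ltn_ind => L IH p.
have [LN|NL] := ltnP L N.
  rewrite (@le_trans _ _ L%:R)// ?ler_nat ?window_count_le//.
  by rewrite -[X in X <= _]add0r lerD ?mulr_ge0// ler_nat ltnW.
have [n /andP[n0 nN] cn] := H p.
have nL : (n <= L)%N by apply: leq_trans NL.
rewrite -(subnKC nL) window_count_cat !natrD mulrDr -addrA lerD//.
by apply: IH; rewrite -subn_gt0 subKn.
Qed.

(** Compactness of the Cantor space, in the form of a limit along a single
    nonprincipal ultrafilter. *)
Lemma pointwise_limit (F : nat -> pred nat) :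
  exists S : pred nat, forall n K, exists2 j, (K <= j)%N &
    forall i, (i < n)%N -> F j i = S i.
Proof.
have [U [UU subU]] := @ultraFilterLemma nat (nbhs \oo) _.
exists (fun i => `[< U [set j | F j i] >]) => n K.
suff H : U [set j | forall i, (i < n)%N -> F j i = `[< U [set j | F j i] >]].
  have UK : U [set j | (K <= j)%N] by apply: subU; exists K.
  by have [j [? ?]] := filter_ex (filterI UK H); exists j.
elim: n => [|n IH]; first by apply: filterE.
have Hn : U [set j | F j n = `[< U [set j | F j n] >]].
  case: asboolP => [//|nU].
  have [//|] := in_ultra_setVsetC [set j | F j n] UU.
  by apply: filterS => j /= /negP/negbTE.
apply: filterS2 IH Hn => j IH Hn i.
by rewrite ltnS leq_eqVlt => /predU1P[->//|/IH].
Qed.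

(** Let [d] be the largest [b] such that members of [V] reach count [b * N] in
    windows of every length [N].  Windows of a length at which no member reaches
    density [d + e] tile the line, which bounds the upper density of every member by [d + e].  For the
    lower bound, a member with at least [(d - e / 2) * L] points in a very long
    window has a position from which all short prefixes have density at least
    [d - e]; otherwise short sparse windows would cover.  A pointwise limit
    of the sets seen from these positions has density exactly [d]. *)
Lemma extremal_natural_density (R : realType) (V : pred nat -> Prop) :
  (forall F p, V F -> V (fun x => F (p + x)%N)) ->
  (forall S, (forall n, exists2 F, V F & forall i, (i < n)%N -> F i = S i) -> V S) ->
  (exists2 c : R, 0 < c & forall N, exists2 F, V F & c * N%:R <= (window_count F 0 N)%:R) ->
  exists2 S, V S & exists2 d : R, 0 < d &
    (fun n => (window_count S 0 n)%:R / n%:R) @ \oo --> d.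
Proof.
move=> Vshift Vclosed [c c0 Vc].
pose E := [set b : R | forall N, exists2 F, V F & b * N%:R <= (window_count F 0 N)%:R].
have Ec : E c by [].
have Eub : ubound E 1.
  move=> b /(_ 1%N) [F _]; rewrite mulr1 => /le_trans; apply.
  by rewrite lern1 window_count_le.
have Esup : has_sup E by split; [exists c | exists 1].
pose d := sup E.
have cd : c <= d by apply: ub_le_sup => //; exists 1.
have d0 : 0 < d by exact: lt_le_trans cd.
have shiftcnt F p q n : window_count (fun x => F (p + x)%N) q n = window_count F (p + q) n.
  by rewrite /window_count; apply: eq_bigr => i _; rewrite addnA.
have upper e : 0 < e -> exists N, forall F, V F -> forall L,
    (window_count F 0 L)%:R <= (d + e) * L%:R + N%:R.
  move=> e0.
  have /existsNP [N HN] : ~ E (d + e).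
    move=> /(ub_le_sup (ex_intro _ 1 Eub)); rewrite -/d; lra.
  have N0 : (0 < N)%N.
    rewrite lt0n; apply/eqP => N0; apply: HN; rewrite N0.
    by have [F VF _] := Vc 0%N; exists F => //; rewrite mulr0.
  exists N => F VF L; apply: window_count_cover => p.
  exists N; first by rewrite N0 leqnn.
  rewrite leNgt; apply/negP => h; apply: HN.
  by exists (fun x => F (p + x)%N); [exact: Vshift | rewrite shiftcnt addn0 ltW].
have lower (K : nat) : exists2 F, V F & forall n, (n <= K)%N ->
    (d - K.+1%:R^-1) * n%:R <= (window_count F 0 n)%:R.
  pose e : R := K.+1%:R^-1; have e0 : 0 < e by rewrite invr_gt0 ltr0n.
  apply: contrapT => H.
  have [b Eb db] : exists2 b, E b & d - e / 2 < b.
    by apply: (sup_adherent (eps := e / 2)) => //; rewrite divr_gt0.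
  pose L := (Num.truncn (K%:R / (e / 2))).+1.
  have LK : K%:R < e / 2 * L%:R.
    by rewrite -ltr_pdivrMl ?divr_gt0// mulrC truncnS_gt.
  (* [L] is so long that the covering error [K] is below the gap between
     [d - e / 2] and [d - e]. *)
  have [F VF bF] := Eb L.
  have : (window_count F 0 L)%:R <= (d - e) * L%:R + K%:R.
    apply: window_count_cover => p; apply: contrapT => Hp; apply: H.
    exists (fun x => F (p + x)%N); first exact: Vshift.
    move=> n nK; rewrite shiftcnt addn0.
    case: (posnP n) => [->|n0]; first by rewrite mulr0.
    rewrite leNgt; apply/negP => h; apply: Hp.
    by exists n; [rewrite n0 | rewrite ltW].
  have L0 : 0 < L%:R :> R by rewrite ltr0n.
  have : (d - e / 2) * L%:R < b * L%:R by rewrite ltr_pM2r.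
  nra.
have /choice [F /all_and2 [VF lowF]] : forall K, exists F, V F /\
    forall n, (n <= K)%N -> (d - K.+1%:R^-1) * n%:R <= (window_count F 0 n)%:R.
  by move=> K; have [F VF lF] := lower K; exists F.
have [S SF] := pointwise_limit F.
have VS : V S by apply: Vclosed => n; have [j _ Fj] := SF n 0%N; exists (F j).
exists S => //; exists d => //.
have low n : d * n%:R <= (window_count S 0 n)%:R.
  apply/ler_addgt0Pr => e e0.
  have [j jK Fj] := SF n (maxn n (Num.truncn (n%:R / e))).
  have -> : window_count S 0 n = window_count (F j) 0 n.
    by apply: eq_bigr => i _; rewrite add0n Fj.
  have := lowF j n (leq_trans (leq_maxl _ _) jK).
  suff : j.+1%:R^-1 * n%:R <= e by move: (_ ^-1) => u; lra.
  rewrite ler_pdivrMl ?ltr0n// -ler_pdivrMr//.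
  apply: (le_trans (ltW (truncnS_gt _))).
  by rewrite ler_nat ltnS (leq_trans (leq_maxr n _)).
apply/cvgrPdist_le => /= e e0.
have [N HN] := upper (e / 2) (divr_gt0 e0 (ltr0Sn _ 1)).
exists (Num.truncn (N%:R / (e / 2))).+1 => // n /= hn.
have n0 : 0 < n%:R :> R by rewrite ltr0n (leq_trans _ hn).
have hN : N%:R <= e / 2 * n%:R.
  rewrite -ler_pdivrMl ?divr_gt0// mulrC (le_trans (ltW (truncnS_gt _)))//.
  by rewrite ler_nat.
rewrite distrC ler_distl ler_pdivlMr// ler_pdivrMr//.
apply/andP; split.
- by rewrite (le_trans _ (low n))// ler_pM2r//; lra.
- rewrite (le_trans (HN S VS n))//.
  lra.
Qed.

(** * A set of natural density whose differences are common returns *)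

(** Windows for densities start at [1], because the density counts positive
    integers. *)
Lemma density_seqE (R : realType) (S : set nat) N :
  density_seq R S N = (window_count (mem S) 1 N)%:R / N%:R.
Proof.
rewrite /density_seq; congr (_%:R / _).
have -> : fset_set (S `&` [set n | (1 <= n <= N)%N]) =
    [fset x in [seq x <- iota 1 N | x \in S]]%fset.
  apply/fsetP => x; rewrite in_fset_set; last first.
    apply: finite_setIr; apply: (sub_finite_set _ (finite_II N.+1)).
    by move=> y /= /andP[_]; rewrite ltnS.
  rewrite !inE mem_filter mem_iota add1n ltnS /=.
  by apply/idP/idP => [/set_mem[/= Sx ->]|/andP[/set_mem Sx xN]];
    [rewrite mem_set | apply/mem_set].
rewrite card_fseq undup_id ?filter_uniq ?iota_uniq// size_filter.
rewrite /window_count -sum1_count big_mkcond /= -[in RHS](subnK (leq0n N)).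
rewrite -(big_mkord xpredT (fun i => ((1 + i)%N \in S) : nat)) /index_iota subn0.
rewrite addn0 subn0 -[1%N in LHS]addn0 iotaDl big_map.
by apply: eq_bigr => i _; case: (_ \in _).
Qed.

Lemma density_seq_bounds (R : realType) S N : 0 <= density_seq R S N <= 1.
Proof.
rewrite density_seqE divr_ge0//=.
case: N => [|N]; first by rewrite invr0 mulr0.
by rewrite ler_pdivrMr ?ltr0n// mul1r ler_nat window_count_le.
Qed.

Lemma bounded_density_seq (R : realType) S : bounded_fun (density_seq R S).
Proof.
exists 1; split => // x x1 n _ /=.
have /andP[u0 u1] := density_seq_bounds R S n.
by rewrite ger0_norm// (le_trans u1)// ltW.
Qed.

Lemma upper_density_le (R : realType) S (b : R) :
  (\forall N \near \oo, density_seq R S N <= b) -> upper_density R S <= b.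
Proof.
move=> [K _ HK]; rewrite /upper_density limn_supE; last exact: bounded_density_seq.
apply: (@le_trans _ _ (sups (density_seq R S) K)).
  apply: ge_inf; last by exists K.
  exists 0 => _ [n _ <-]; rewrite /sups.
  have /andP[u0 _] := density_seq_bounds R S n.
  apply: (le_trans u0); apply: ub_le_sup; last by exists n => /=.
  by exists 1 => _ [m _ <-]; have /andP[] := density_seq_bounds R S m.
apply: ge_sup => [|_ [n /= Kn <-]]; last exact: HK.
by exists (density_seq R S K); exists K => /=.
Qed.

Lemma upper_density_ge (R : realType) S (b : R) :
  (forall K, exists2 N, (K <= N)%N & b <= density_seq R S N) ->
  b <= upper_density R S.
Proof.
move=> H; rewrite /upper_density limn_supE; last exact: bounded_density_seq.
apply: lb_le_inf; first by eexists; exists 0%N.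
move=> _ [K _ <-]; have [N KN bN] := H K.
apply: (le_trans bN); apply: ub_le_sup; last by exists N.
by exists 1 => _ [m _ <-]; have /andP[] := density_seq_bounds R S m.
Qed.

(** The mean is taken along initial segments on which [S] has at least half its
    upper density; it never exceeds the upper density of another set, which gives
    the second property. *)
Lemma mean_of_upper_density (R : realType) (S : set nat) :
  0 < upper_density R S ->
  exists2 Lam, @invariant_mean R Lam & 0 < Lam (fun x => (x \in S)%:R) /\
    forall T : set nat, 0 < Lam (fun x => (x \in T)%:R) -> 0 < upper_density R T.
Proof.
move=> S0; pose b := upper_density R S / 2.
have b0 : 0 < b by rewrite divr_gt0.
have /choice [L HL] : forall j, exists N, (j < N)%N /\ b <= density_seq R S N.
  move=> j; apply: contrapT => H.
  suff : upper_density R S <= b by rewrite /b; lra.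
  apply: upper_density_le; exists j.+1 => // N /= jN.
  by rewrite leNgt; apply/negP => h; apply: H; exists N; rewrite ltW.
have /all_and2 [jL bL] := HL.
have [Lam IM Lamle] := exists_mean R (fun=> 1%N) jL.
exists Lam => //; split.
  suff : Lam (fun x => - (x \in S)%:R) <= - b.
    by rewrite (meanN IM) ?lerN2; [exact: lt_le_trans | solve_bounded].
  apply: Lamle; first by solve_bounded.
  exists 0%N => // j _; have := bL j.
  rewrite density_seqE window_count_avg -lerN2 => h; apply: le_trans h.
  by rewrite /window_avg sumrN mulNr.
move=> T; set l := Lam _ => l0.
apply: (@lt_le_trans _ _ (l / 2)); first by rewrite divr_gt0.
apply: upper_density_ge => K; apply: contrapT => H.
suff : l <= l / 2 by lra.
apply: Lamle; first by solve_bounded.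
exists K => // j /= Kj; rewrite -window_count_avg -density_seqE leNgt; apply/negP => h.
apply: H; exists (L j); last exact: ltW.
by rewrite (leq_trans Kj)// ltnW.
Qed.

Definition diffs_in (Q : nat -> Prop) (F : pred nat) : Prop :=
  forall x y, (x < y)%N -> F x -> F y -> Q (y - x)%N.

Definition dense_patterns (R : realType) (Q : nat -> Prop) : Prop :=
  exists2 c : R, 0 < c &
    forall N, exists2 F, diffs_in Q F & c * N%:R <= (window_count F 0 N)%:R.

Definition dense_return (R : realType) (S : set nat) (h : nat) : Prop :=
  0 < upper_density R (S `&` shift_set S h).

(** Fix [N].  Removing from [S] the points starting a difference [h < N] of zero
    mean leaves the mean of [S] unchanged, so the average over [x] of the size of
    the intersection of [F] with the remaining set translated by [x] is at least
    the size of [F] times the mean of [S]; some [x] does at least half as well. *)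
Lemma dense_patterns_return (R : realType) (Q : nat -> Prop) (S : set nat) :
  S `<=` posnat -> 0 < upper_density R S -> dense_patterns R Q ->
  dense_patterns R (fun h => Q h /\ dense_return R S h).
Proof.
move=> Spos /mean_of_upper_density [Lam IM [LS Lret]] [c c0 Hc].
set b := Lam _ in LS.
exists (c * b / 2); first by rewrite divr_gt0 ?mulr_gt0.
move=> N; have [F FQ cF] := Hc N.
(* [good] is [S] with the starting points of bad differences removed. *)
pose bad h := ~~ `[< 0 < Lam (fun x => (x \in S `&` shift_set S h)%:R) >].
pose good x := (x \in S) && [forall h : 'I_N, bad h ==> ((x + h)%N \notin S)].
pose ret h x : R := ((x \in S) && ((x + h)%N \in S))%:R.
have bret h : bounded_seq (ret h) by exact: bounded_seq_bool.
have retE h : Lam (ret h) = Lam (fun x => (x \in S `&` shift_set S h)%:R).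
  congr (Lam _); apply/funext => x; congr ((_ : bool)%:R).
  rewrite in_setI; case: (boolP (x \in S)) => //= /set_mem Sx.
  apply/idP/idP => [/set_mem ?|/set_mem [_ ?]]; apply/mem_set => //.
  by split => //; exact: Spos.
have bgood : b <= Lam (fun x => (good x)%:R).
  apply: (@le_trans _ _ (Lam (fun x => (x \in S)%:R - \sum_(h < N | bad h) ret h x))).
    rewrite (meanB IM); [|by solve_bounded|]; last first.
      under eq_fun do rewrite big_mkcond /=.
      by apply: bounded_seq_sum => h; case: (bad h); solve_bounded.
    rewrite (mean_sum IM) -/b; last by move=> h; exact: bret.
    rewrite lerDl oppr_ge0; apply: sumr_le0 => h.
    by move=> /asboolPn/negP; rewrite -leNgt retE.
  apply: (mean_le IM); [|by solve_bounded|].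
    apply: bounded_seqD; first by solve_bounded.
    apply: bounded_seqN; under eq_fun do rewrite big_mkcond /=.
    by apply: bounded_seq_sum => h; case: (bad h); solve_bounded.
  move=> x; rewrite /good; case: (boolP (x \in S)) => [xS|xS] /=; last first.
    by rewrite add0r oppr_le0 sumr_ge0.
  case: forallP => [_|/existsNP [h]].
    by rewrite gerBl sumr_ge0.
  move=> /negP; rewrite negb_imply negbK => /andP[bh xh].
  rewrite (bigD1 h)//= /ret xS xh opprD addrA subrr add0r oppr_le0.
  by rewrite sumr_ge0.
pose g x : R := \sum_(i < N) (F i)%:R * (good (x + i)%N)%:R.
have bg : bounded_seq g by rewrite /g; solve_bounded.
have Lg : b * (c * N%:R) <= Lam g.
  rewrite /g (mean_sum IM); last by move=> i; solve_bounded.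
  apply: (@le_trans _ _ (b * (window_count F 0 N)%:R)); first by rewrite ler_pM2l.
  rewrite natr_sum mulr_sumr; apply: ler_sum => i _.
  rewrite (meanZ IM); last by solve_bounded.
  rewrite (mean_shift IM i (f := fun x => (good x)%:R)); last by solve_bounded.
  by rewrite mulrC ler_wpM2l.
have [x Hx] : exists x, c * b / 2 * N%:R <= g x.
  apply: contrapT => /forallNP H.
  have Hlt x : g x < c * b / 2 * N%:R by rewrite ltNge; exact/negP.
  have : Lam g <= c * b / 2 * N%:R.
    rewrite -[leRHS](mean_cst IM); apply: (mean_le IM) => //; first by solve_bounded.
    by move=> x; exact: ltW.
  have N0 : 0 <= N%:R :> R by [].
  have cb : 0 < c * b by rewrite mulr_gt0.
  have g0 : 0 <= g 0%N by rewrite /g sumr_ge0// => i _; rewrite mulr_ge0.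
  have := Hlt 0%N; nra.
exists (fun i => [&& F i, (i < N)%N & good (x + i)%N]); last first.
  apply: (le_trans Hx); rewrite /g natr_sum ler_sum// => i _.
  by rewrite add0n ltn_ord/=; case: (F i); rewrite ?mul0r ?mul1r.
move=> i j ij /and3P[Fi iN /andP[xi /forallP gi]] /and3P[Fj jN /andP[xj _]].
split; first exact: FQ.
rewrite /dense_return; apply: Lret.
have hN : (j - i < N)%N by rewrite (leq_ltn_trans (leq_subr _ _)).
have := gi (Ordinal hN); rewrite /= -addnA subnKC ?(ltnW ij)// xj implybF.
by rewrite /bad negbK => /asboolP.
Qed.

Lemma dense_patterns_all (R : realType) (k : nat) (S_ : 'I_k -> set nat) :
  (forall i, S_ i `<=` posnat) -> (forall i, 0 < upper_density R (S_ i)) ->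
  dense_patterns R (fun h => forall i, dense_return R (S_ i) h).
Proof.
move=> Spos Sdens.
have weaken (P Q : nat -> Prop) : (forall h, P h -> Q h) ->
    dense_patterns R P -> dense_patterns R Q.
  move=> PQ [c c0 H]; exists c => // N; have [F FP ?] := H N.
  by exists F => // x y xy Fx Fy; apply: PQ; exact: FP.
apply: (@weaken (fun h => forall i, i \in enum 'I_k -> dense_return R (S_ i) h)).
  by move=> h H i; apply: H; rewrite mem_enum.
elim: (enum _) => [|i s IH].
  exists 1 => // N; exists xpredT => //.
  by rewrite mul1r ler_nat /window_count sum1_card card_ord.
apply: weaken (dense_patterns_return (Spos i) (Sdens i) IH) => h [H Hi] j.
by rewrite inE => /predU1P [->|/H].
Qed.

(** The extremal set lives on the natural numbers from [0]; it is translated by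
    one to become a set of positive integers, which keeps its differences. *)
Lemma natural_density_of_returns (R : realType) (k : nat) (S_ : 'I_k -> set nat) :
  (forall i, S_ i `<=` posnat) -> (forall i, 0 < upper_density R (S_ i)) ->
  exists2 S : set nat, S `<=` posnat & [/\
    exists2 d : R, has_density S d & 0 < d &
    forall x y, (x < y)%N -> S x -> S y ->
      forall i, dense_return R (S_ i) (y - x)].
Proof.
move=> Spos Sdens.
have [S VS [d d0 Sd]] : exists2 S,
    diffs_in (fun h => forall i, dense_return R (S_ i) h) S &
    exists2 d : R, 0 < d & (fun n => (window_count S 0 n)%:R / n%:R) @ \oo --> d.
  apply: extremal_natural_density (dense_patterns_all Spos Sdens).
  - move=> F p VF x y xy Fx Fy.
    by have := VF _ _ _ Fx Fy; rewrite subnDl ltn_add2l; apply.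
  - move=> S HS x y xy Sx Sy; have [F VF FS] := HS y.+1.
    by apply: VF => //; rewrite FS// ltnS ltnW.
exists [set n | (0 < n)%N && S n.-1]; first by move=> n /= /andP[].
split.
  exists d => //; rewrite /has_density /upper_density /lower_density.
  suff H : density_seq R [set n | (0 < n)%N && S n.-1] @ \oo --> d.
    by split; rewrite (cvg_limn_inf_sup H).
  have -> // : density_seq R [set n | (0 < n)%N && S n.-1] =
    (fun n => (window_count S 0 n)%:R / n%:R).
  apply/funext => N; rewrite density_seqE; congr (_%:R / _).
  apply: eq_bigr => i _; congr (nat_of_bool _).
  by apply/idP/idP => [/set_mem//|?]; apply/mem_set.
move=> x y xy /= /andP[x0 Sx] /andP[y0 Sy].
have := VS x.-1 y.-1 _ Sx Sy.
rewrite (_ : (y.-1 - x.-1 = y - x)%N); last by lia.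
by apply; lia.
Qed.

(** * Polynomial van der Corput estimate *)

(** Nonnegative coefficients keep the values and the differences of the
    polynomial inside the natural numbers, where shifts are defined. *)
Definition nat_poly (d : nat) (p : nat -> nat) : Prop :=
  exists2 a : nat -> nat, (0 < a d)%N &
    forall n, p n = (\sum_(i < d.+1) a i * n ^ i)%N.

Lemma nat_poly_diff d p h : (0 < h)%N -> nat_poly d.+1 p ->
  (forall n, (p n <= p (n + h))%N) /\ nat_poly d (fun n => (p (n + h) - p n)%N).
Proof.
move=> h0 [a ad pE].
(* The coefficients of the difference: those of [p (n + h)] in powers of [n],
   by the binomial formula, with the diagonal part [p n] removed. *)
pose e j := (\sum_(i < d.+2 | i != j :> nat) a i * ('C(i, j) * h ^ (i - j)))%N.
have e_top : e d.+1 = 0%N.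
  rewrite /e big1// => i ij; rewrite bin_small ?mul0n ?muln0//.
  by rewrite ltn_neqAle ij -ltnS ltn_ord.
have phE n : p (n + h)%N = (p n + \sum_(j < d.+1) e j * n ^ j)%N.
  have -> : (\sum_(j < d.+1) e j * n ^ j = \sum_(j < d.+2) e j * n ^ j)%N.
    by rewrite [RHS]big_ord_recr /= e_top mul0n addn0.
  rewrite !pE -big_split /=.
  transitivity (\sum_(i < d.+2) \sum_(j < d.+2)
      a i * ('C(i, j) * h ^ (i - j)) * n ^ j)%N.
    apply: eq_bigr => i _; rewrite addnC expnDn big_distrr /=.
    rewrite (big_ord_widen d.+2 (fun j => a i * ('C(i, j) * (h ^ (i - j) * n ^ j)))%N)//.
    rewrite big_mkcond /=; apply: eq_bigr => j _; case: ifP => [_|]; first by lia.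
    by rewrite ltnS => /negbT; rewrite -ltnNge => /bin_small ->; rewrite mul0n muln0.
  rewrite exchange_big; apply: eq_bigr => j _.
  rewrite (bigD1 j)//= binn subnn expn0 muln1 muln1; congr (_ + _)%N.
  by rewrite /e big_distrl.
split=> [n|]; first by rewrite phE leq_addr.
exists e; last by move=> n; rewrite phE addKn.
rewrite /e (bigD1 ord_max)/= ?gtn_eqF// addn_gt0; apply/orP; left.
by rewrite !muln_gt0 ad bin_gt0 leqnSn expn_gt0 h0.
Qed.

Definition poly_avg (R : realType) (f : nat -> R) (p : nat -> nat) (L x : nat) : R :=
  (\sum_(n < L) f (x + p n)%N) / L%:R.

Lemma bounded_poly_avg (R : realType) (f : nat -> R) p L :
  bounded_seq f -> bounded_seq (poly_avg f p L).
Proof. by move=> bf; rewrite /poly_avg; solve_bounded. Qed.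

(** Smallness of averages along every progression, in mean: the absence of
    correlation with periodic behaviour, the only obstruction for polynomials. *)
Definition uniform_up_to (R : realType) (Lam : (nat -> R) -> R) (e : R) (f : nat -> R) :=
  forall q, (0 < q)%N -> exists L0, forall L, (L0 <= L)%N ->
    Lam (fun x => `|poly_avg f (fun n => (q * n)%N) L x|) <= e.

Lemma sum_window_shift (R : realType) (u : nat -> R) (L h : nat) :
  (forall n, `|u n| <= 1) ->
  `|\sum_(n < L) u n - \sum_(n < L) u (n + h)%N| <= 2 * h%:R.
Proof.
move=> u1; elim: h => [|h IH].
  under [X in _ - X]eq_bigr do rewrite addn0.
  by rewrite subrr normr0 mulr0.
have E : \sum_(n < L) u (n + h)%N + u (L + h)%N =
    u h + \sum_(n < L) u (n + h.+1)%N.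
  rewrite -(big_ord_recr L (fun n => u (n + h)%N)) /= big_ord_recl add0n.
  by congr (_ + _); apply: eq_bigr => i _; rewrite addnS.
have := u1 h; have := u1 (L + h)%N; move: IH.
rewrite -[h.+1]addn1 natrD !ler_norml addn1 => /andP[??] /andP[??] /andP[??].
by apply/andP; split; lra.
Qed.

(** Replacing each term by the average of the [H] terms from it on only changes
    the ends of the window: the first step of van der Corput's inequality. *)
Lemma window_sum_smoothing (R : realType) (u : nat -> R) (L H : nat) :
  (0 < H)%N -> (0 < L)%N -> (forall n, `|u n| <= 1) ->
  `|(\sum_(n < L) u n) / L%:R -
    (\sum_(n < L) (\sum_(h < H) u (n + h)%N) / H%:R) / L%:R| <= 2 * H%:R / L%:R.
Proof.
move=> H0 L0 u1.
have H0' : 0 < H%:R :> R by rewrite ltr0n.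
have L0' : 0 < L%:R :> R by rewrite ltr0n.
rewrite -mulrBl normrM normfV normr_nat ler_pM2r ?invr_gt0//.
rewrite -mulr_suml exchange_big /=.
have -> : \sum_(n < L) u n = (\sum_(h < H) \sum_(n < L) u n) / H%:R.
  by rewrite sumr_const card_ord -[_ *+ _]mulr_natr mulfK// gt_eqF.
rewrite -mulrBl -sumrB normrM normfV normr_nat ler_pdivrMr//.
apply: (le_trans (ler_norm_sum _ _ _)).
apply: (@le_trans _ _ (\sum_(h < H) 2 * H%:R)).
  apply: ler_sum => h _; apply: (le_trans (sum_window_shift _ _ u1)).
  by rewrite ler_pM2l// ler_nat ltnW.
by rewrite sumr_const card_ord -[_ *+ _]mulr_natr.
Qed.

(** Used in place of the Cauchy-Schwarz inequality for means, with [t] of the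
    size of the expected bound. *)
Lemma norm_le_scaled_sqr (R : realType) (t y : R) :
  0 < t -> `|y| <= t / 2 + y ^+ 2 / (2 * t).
Proof.
move=> t0.
have -> : t / 2 + y ^+ 2 / (2 * t) = (t ^+ 2 + y ^+ 2) / (2 * t) by field; rewrite gt_eqF.
rewrite ler_pdivlMr ?mulr_gt0// -(real_normK (num_real y)).
have := sqr_ge0 (t - `|y|); rewrite !expr2; nra.
Qed.

(** Induction on the degree.  In degree one the polynomial average is a translate
    of an average along a progression.  In higher degree, smooth the window sum
    over blocks of length [H] and bound it by the mean square of block averages.
    Expanding the square, the diagonal contributes [1 / H], and for the
    off-diagonal terms shift invariance turns the product of two translates into
    a correlation along the difference polynomial, of smaller degree.  The bound
    is uniform in the start [M] of the window because differences of [p] at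
    distance [h' - h] are the same polynomial read from another start. *)
Lemma poly_correlation (R : realType) (d : nat) (tau : R) : 0 < tau ->
  exists2 e : R, 0 < e & forall Lam, @invariant_mean R Lam ->
    forall f, (forall x, `|f x| <= 1) -> uniform_up_to Lam e f ->
    forall p, nat_poly d.+1 p -> exists L0, forall L, (L0 <= L)%N -> forall M,
      `|Lam (fun x => f x * poly_avg f (fun n => p (M + n)%N) L x)| <= tau.
Proof.
elim: d tau => [|d IH] tau tau0.
  exists tau => // Lam IM f f1 fu p [a a1 pE].
  have bf : bounded_seq f by exists 1.
  have [L0 HL0] := fu _ a1; exists L0 => L L0L M.
  apply: le_trans (HL0 _ L0L).
  pose g := poly_avg f (fun n => (a 1 * n)%N) L.
  have bg : bounded_seq g by exact: bounded_poly_avg.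
  pose s := (a 0 + a 1 * M)%N.
  have -> : (fun x => f x * poly_avg f (fun n => p (M + n)%N) L x) =
      (fun x => f x * g (x + s)%N).
    apply/funext => x; congr (_ * (_ / _)); apply: eq_bigr => n _; congr f.
    rewrite pE !big_ord_recl big_ord0 /bump /= expn0 expn1 mulnDr /s.
    by rewrite (_ : bump 0 0 = 1%N)//; lia.
  apply: (le_trans (mean_norm IM _)); first by solve_bounded.
  rewrite -(mean_shift IM s (f := fun x => `|g x|)); last by solve_bounded.
  apply: (mean_le IM); [by solve_bounded|by solve_bounded|] => x.
  by rewrite normrM ler_piMl.
have tau'0 : 0 < tau ^+ 2 / 4 by rewrite divr_gt0// exprn_gt0.
have [e e0 He] := IH _ tau'0.
exists e => // Lam IM f f1 fu p pp.
have bf : bounded_seq f by exists 1.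
pose H := (Num.truncn (4 / tau ^+ 2)).+1.
have Hpos : (0 < H)%N by [].
have H0 : 0 < H%:R :> R by rewrite ltr0n.
have HH : H%:R^-1 <= tau ^+ 2 / 4.
  rewrite -[leRHS]invrK lef_pV2 ?posrE ?invr_gt0// invf_div.
  exact/ltW/truncnS_gt.
clearbody H.
have /choice [L0 HL0] : forall k, exists L0, (0 < k)%N ->
    forall L, (L0 <= L)%N -> forall M, `|Lam (fun x => f x *
       poly_avg f (fun n => (p (M + n + k) - p (M + n))%N) L x)| <= tau ^+ 2 / 4.
  move=> k; case: (posnP k) => [->|k0]; first by exists 0%N.
  have [_ pk] := nat_poly_diff k0 pp.
  by have [L0 HL0] := He Lam IM f f1 fu _ pk; exists L0 => _ L /HL0.
(* Makes the smoothing error [2 * H / L] at most [tau / 4]; the scaled squares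
   account for [tau / 2] and for another [tau / 4]. *)
pose L1 := (Num.truncn (8 * H%:R / tau)).+1.
exists (maxn L1 (\max_(k < H) L0 k)) => L; rewrite geq_max => /andP[L1L /bigmax_leqP L0L] M.
have Lpos : 0 < L%:R :> R by rewrite ltr0n (leq_trans _ L1L).
have L1L' : 2 * H%:R / L%:R <= tau / 4.
  have : 8 * H%:R / tau <= L%:R.
    by apply: (le_trans (ltW (truncnS_gt _))); rewrite ler_nat.
  rewrite ler_pdivrMr// ler_pdivrMr//; lra.
pose v n x := f (x + p (M + n)%N)%N.
have bv n : bounded_seq (v n) by rewrite /v; solve_bounded.
pose B n x := (\sum_(h < H) v (n + h)%N x) / H%:R.
have bB n : bounded_seq (B n).
  by apply: bounded_seqM; [apply: bounded_seq_sum => h; exact: bv | solve_bounded].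
have cross h h' : (h < h' < H)%N ->
    \sum_(n < L) Lam (fun x => v (n + h)%N x * v (n + h')%N x) <= L%:R * (tau ^+ 2 / 4).
  move=> /andP[hh' h'H].
  have k0 : (0 < h' - h)%N by rewrite subn_gt0.
  have kH : (h' - h < H)%N by rewrite (leq_ltn_trans (leq_subr _ _)).
  have [pmono _] := nat_poly_diff k0 pp.
  have := HL0 _ k0 L (L0L (Ordinal kH) isT) (M + h)%N; rewrite /=.
  move=> /(le_trans (ler_norm _)); rewrite -(ler_pM2l Lpos); apply: le_trans.
  pose D n := (p (M + h + n + (h' - h)) - p (M + h + n))%N.
  have -> : L%:R * Lam (fun x => f x * poly_avg f D L x) =
      \sum_(n < L) Lam (fun x => f x * f (x + D n)%N).
    rewrite -(meanZ IM); last by apply: bounded_seqM => //; exact: bounded_poly_avg.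
    rewrite -(mean_sum IM); last by move=> i; solve_bounded.
    congr (Lam _); apply/funext => x.
    by rewrite -mulr_sumr /poly_avg mulrCA; congr (_ * _); rewrite mulrC divfK ?gt_eqF.
  apply: ler_sum => n _; rewrite le_eqVlt; apply/orP; left; apply/eqP.
  rewrite -[RHS](mean_shift IM (p (M + h + n)%N)); last by solve_bounded.
  congr (Lam _); apply/funext => x; rewrite /v; congr (f _ * f _).
    by congr (_ + p _)%N; lia.
  have := pmono (M + h + n)%N; rewrite /D.
  have -> : (M + h + n + (h' - h) = M + (n + h'))%N by lia.
  by lia.
have offdiag h h' : (h < H)%N -> (h' < H)%N ->
    \sum_(n < L) Lam (fun x => v (n + h)%N x * v (n + h')%N x) <=
    L%:R * ((h == h')%:R + tau ^+ 2 / 4).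
  move=> hH h'H; case: (ltngtP h h') => [hh'|h'h|->].
  - by rewrite add0r; apply: cross; rewrite hh'.
  - rewrite add0r; apply: le_trans (cross h' h _); last by rewrite h'h.
    apply: ler_sum => n _; rewrite le_eqVlt; apply/orP; left; apply/eqP.
    by congr (Lam _); apply/funext => x; rewrite mulrC.
  - apply: (@le_trans _ _ (\sum_(n < L) 1)).
      apply: ler_sum => n _; rewrite -[leRHS](mean_cst IM).
      apply: (mean_le IM); [by solve_bounded|by solve_bounded|].
      by move=> x; rewrite (le_trans (ler_norm _))// normrM mulr_ile1 ?normr_ge0 //; exact: f1.
    rewrite sumr_const card_ord; apply: ler_peMr => //.
    by rewrite lerDl ltW.
have sqB : (\sum_(n < L) Lam (fun x => B n x ^+ 2)) / L%:R <= tau ^+ 2 / 2.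
  rewrite ler_pdivrMr//.
  have -> : \sum_(n < L) Lam (fun x => B n x ^+ 2) =
     (\sum_(h < H) \sum_(h' < H)
        \sum_(n < L) Lam (fun x => v (n + h)%N x * v (n + h')%N x)) / H%:R ^+ 2.
    transitivity (\sum_(n < L) (\sum_(h < H) \sum_(h' < H)
        Lam (fun x => v (n + h)%N x * v (n + h')%N x)) / H%:R ^+ 2).
      apply: eq_bigr => n _.
      rewrite (eq_bigr (fun h : 'I_H => Lam (fun x => \sum_(h' < H)
          v (n + h)%N x * v (n + h')%N x))); last first.
        by move=> h _; rewrite (mean_sum IM)// => h'; solve_bounded.
      rewrite -(mean_sum IM); last by move=> h; solve_bounded.
      rewrite mulrC -(meanZ IM); last by solve_bounded.
      congr (Lam _); apply/funext => x.
      by rewrite /B expr_div_n expr2 big_distrlr /= mulrC.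
    rewrite -mulr_suml exchange_big /=; congr (_ / _).
    by apply: eq_bigr => h _; rewrite exchange_big.
  rewrite ler_pdivrMr ?exprn_gt0//.
  apply: (@le_trans _ _ (\sum_(h < H) \sum_(h' < H)
      L%:R * ((h == h' :> nat)%:R + tau ^+ 2 / 4))).
    by do 2!apply: ler_sum => ? _; exact: offdiag.
  have -> : \sum_(h < H) \sum_(h' < H) L%:R * ((h == h' :> nat)%:R + tau ^+ 2 / 4) =
      L%:R * (H%:R + tau ^+ 2 / 4 * H%:R * H%:R).
    transitivity (L%:R * \sum_(h < H) (1 + tau ^+ 2 / 4 * H%:R)); last first.
      by rewrite sumr_const card_ord -[(1 + _) *+ _]mulr_natr mulrDl mul1r.
    rewrite mulr_sumr; apply: eq_bigr => h _.
    rewrite -mulr_sumr big_split /= sumr_const card_ord mulr_natr.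
    congr (_ * (_ + _)); rewrite (bigD1 h)//= eqxx big1 ?addr0//.
    by move=> i /negbTE ih; rewrite -[_ == _]/(h == i) eq_sym ih.
  have HH' : H%:R <= tau ^+ 2 / 4 * H%:R ^+ 2.
    by rewrite expr2 mulrA ler_pMl// -ler_pdivrMr// div1r.
  have -> : tau ^+ 2 / 2 * L%:R * H%:R ^+ 2 =
      L%:R * (tau ^+ 2 / 4 * H%:R ^+ 2 + tau ^+ 2 / 4 * H%:R * H%:R) by field.
  by rewrite ler_pM2l// lerD.
have pointwise x : `|f x * poly_avg f (fun n => p (M + n)%N) L x| <=
    tau / 4 + (\sum_(n < L) (tau / 2 + B n x ^+ 2 * (2 * tau)^-1)) / L%:R.
  rewrite normrM; apply: (@le_trans _ _ `|poly_avg f (fun n => p (M + n)%N) L x|).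
    by rewrite ler_piMl.
  have := @window_sum_smoothing R (fun n => v n x) L H Hpos _ (fun n => f1 _).
  rewrite -(ltr_nat R) => /(_ Lpos) wm.
  rewrite -[poly_avg _ _ _ _](subrK ((\sum_(n < L) B n x) / L%:R)).
  rewrite (le_trans (ler_normD _ _))// lerD//.
    exact: le_trans wm L1L'.
  rewrite normrM normfV normr_nat ler_pM2r ?invr_gt0//.
  apply: (le_trans (ler_norm_sum _ _ _)); apply: ler_sum => n _.
  exact: norm_le_scaled_sqr.
have bB2 n : bounded_seq (fun x => B n x ^+ 2).
  by under eq_fun do rewrite expr2; solve_bounded.
apply: (le_trans (mean_norm IM _)); first by apply: bounded_seqM => //; exact: bounded_poly_avg.
apply: (@le_trans _ _ (Lam (fun x => tau / 4 +
    (\sum_(n < L) (tau / 2 + B n x ^+ 2 * (2 * tau)^-1)) / L%:R))).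
  apply: (mean_le IM) => //; last by solve_bounded.
  by apply: bounded_seq_norm; apply: bounded_seqM => //; exact: bounded_poly_avg.
rewrite (meanD IM); [|by solve_bounded|by solve_bounded]; rewrite (mean_cst IM).
have -> : Lam (fun x => (\sum_(n < L) (tau / 2 + B n x ^+ 2 * (2 * tau)^-1)) / L%:R) =
    tau / 2 + (\sum_(n < L) Lam (fun x => B n x ^+ 2)) / L%:R / (2 * tau).
  under eq_fun do rewrite mulrC.
  rewrite (meanZ IM); last by solve_bounded.
  rewrite (mean_sum IM); last by move=> n; solve_bounded.
  under eq_bigr => n _.
    rewrite (meanD IM); [|by solve_bounded|by solve_bounded]; rewrite (mean_cst IM).
    under eq_fun do rewrite mulrC.
    rewrite (meanZ IM); last exact: bB2.
    over.
  rewrite big_split /= sumr_const card_ord -mulr_sumr -[_ *+ _]mulr_natr.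
  by field; rewrite !gt_eqF.
suff : (\sum_(n < L) Lam (fun x => B n x ^+ 2)) / L%:R / (2 * tau) <= tau / 4 by lra.
rewrite ler_pdivrMr ?mulr_gt0//.
have -> : tau / 4 * (2 * tau) = tau ^+ 2 / 2 by field.
exact: sqB.
Qed.

(** * Sets avoiding power differences have density zero *)

(** The factor [b] is there for stability under rescaling: restricting to a
    progression of step [q] and dividing by [q] turns [b] into [b * q ^ (c - 1)]
    and the windows of [n] into their multiples of [q]. *)
Definition avoids_powers (c : nat) (A : pred nat) : Prop :=
  exists2 b, (0 < b)%N & forall L, exists M, forall n x,
    (M <= n < M + L)%N -> A x -> ~~ A (x + b * n ^ c)%N.

Lemma avoids_powers_dilate c A q r : (0 < c)%N -> (0 < q)%N ->
  avoids_powers c A -> avoids_powers c (fun m => A (r + q * m)%N).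
Proof.
move=> c0 q0 [b b0 H]; exists (b * q ^ c.-1)%N; first by rewrite muln_gt0 b0 expn_gt0 q0.
move=> L; have [M HM] := H (q * L).+1; exists (M %/ q).+1 => n x /andP[Mn nL] Ax.
have -> : (r + q * (x + b * q ^ c.-1 * n ^ c) = r + q * x + b * (q * n) ^ c)%N.
  by rewrite expnMn -[in RHS](prednK c0) expnS prednK//; lia.
apply: HM => //; apply/andP; split.
  rewrite (@leq_trans (q * (M %/ q).+1))// ?leq_mul2l ?Mn ?orbT//.
  by rewrite mulnC ltnW// ltn_ceil.
rewrite addnS ltnS (@leq_trans (q * (M %/ q + L)))//.
  by rewrite leq_mul2l -ltnS -addSn nL orbT.
by rewrite mulnDr leq_add2r mulnC leq_divM.
Qed.

(** The windows are anywhere and of length as large as wanted: the upper Banach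
    density is at least [b]. *)
Definition banach_density_ge (R : realType) (A : pred nat) (b : R) : Prop :=
  forall L0, exists2 L, (L0 <= L)%N & exists x, b * L%:R <= (window_count A x L)%:R.

Lemma mean_of_banach_density (R : realType) (A : pred nat) (b : R) :
  banach_density_ge A b ->
  exists2 Lam, @invariant_mean R Lam & b <= Lam (fun x => (A x)%:R).
Proof.
move=> HA.
have /choice [w Hw] : forall j, exists w : nat * nat, (j < w.2)%N /\
    b * w.2%:R <= (window_count A w.1 w.2)%:R.
  by move=> j; have [L jL [x bx]] := HA j.+1; exists (x, L).
have /all_and2 [jL bL] := Hw.
have [Lam IM Lamle] := exists_mean R (fun j => (w j).1) jL.
exists Lam => //; rewrite -lerN2 -(meanN IM); last by solve_bounded.
apply: Lamle; first by solve_bounded.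
exists 0%N => // j _.
suff : b <= window_avg (fun x => (A x)%:R) (w j).1 (w j).2.
  by rewrite -lerN2 => h; apply: le_trans h; rewrite /window_avg sumrN mulNr.
by rewrite -window_count_avg ler_pdivlMr// ltr0n (leq_ltn_trans _ (jL j)).
Qed.

(** The balanced averages have mean zero and are at most [e] everywhere, so their
    absolute values are at most [2 * e] minus the averages themselves. *)
Lemma uniform_up_to_of_no_increment (R : realType) Lam (IM : @invariant_mean R Lam)
    (A : pred nat) (e : R) :
  let a := Lam (fun x => (A x)%:R) in
  (forall q, (0 < q)%N -> exists L0, forall L, (L0 <= L)%N -> forall x,
     poly_avg (fun y => (A y)%:R) (fun n => (q * n)%N) L x <= a + e) ->
  uniform_up_to Lam (2 * e) (fun x => (A x)%:R - a).
Proof.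
move=> a H q q0; have [L0 HL0] := H q q0.
exists (maxn 1 L0) => L; rewrite geq_max => /andP[L1 L0L].
have Lpos : 0 < L%:R :> R by rewrite ltr0n.
have bf : bounded_seq (fun x => (A x)%:R - a) by solve_bounded.
set f := fun x => _ in bf *.
set g := poly_avg f _ L.
have bg : bounded_seq g by exact: bounded_poly_avg.
have Lf : Lam f = 0 by rewrite (meanB IM) ?(mean_cst IM) ?subrr//; solve_bounded.
have Lg : Lam g = 0.
  rewrite /g /poly_avg; under eq_fun do rewrite mulrC.
  rewrite (meanZ IM); last by solve_bounded.
  rewrite (mean_sum IM) ?big1 ?mulr0//; last by move=> i; solve_bounded.
  by move=> i _; rewrite (mean_shift IM _ (f := f)).
have ge x : g x <= e.
  have := HL0 L L0L x; rewrite /g /poly_avg /f sumrB sumr_const card_ord.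
  rewrite -[a *+ _]mulr_natr mulrBl mulfK ?gt_eqF//; lra.
have e0 : 0 <= e by rewrite -Lg -(mean_cst IM e); apply: (mean_le IM) => //; solve_bounded.
rewrite -[leRHS]subr0 -Lg -(mean_cst IM (2 * e)) -(meanB IM)//; last by solve_bounded.
apply: (mean_le IM); [by solve_bounded|by solve_bounded|] => x.
by have gx := ge x; rewrite ler_norml; apply/andP; split; lra.
Qed.

(** Density increment.  Choose [B] in the class with density within [e'] of the
    supremum [al]; its restrictions to progressions, being in the class, do not
    exceed [al + e'], so its balanced indicator is uniform and [poly_correlation]
    bounds its average correlation on an avoided window by [al ^+ 2 / 8].  There
    the correlation is exactly [- a ^+ 2], with [a >= al / 2]. *)
Lemma avoids_powers_banach_null (R : realType) c (A : pred nat) (b : R) :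
  (0 < c)%N -> 0 < b -> avoids_powers c A -> ~ banach_density_ge A b.
Proof.
move=> c0 b0 Aav Ab.
pose E := [set b : R | exists2 A, avoids_powers c A & banach_density_ge A b].
have Eb : E b by exists A.
have Eub : ubound E 1.
  move=> {b0 Ab Eb}b [B _ /(_ 1%N) [L L0 [x]]] => /le_trans - /(_ L%:R).
  by rewrite ler_nat window_count_le => /(_ isT); rewrite ger_pMl// ltr0n.
have Esup : has_sup E by split; [exists b | exists 1].
pose al := sup E.
have al0 : 0 < al by apply: (lt_le_trans b0); apply: ub_le_sup => //; exists 1.
have [e e0 He] := @poly_correlation R c.-1 (al ^+ 2 / 8)
  (divr_gt0 (exprn_gt0 2 al0) (ltr0Sn _ 7)).
rewrite prednK// in He.
pose e' := Num.min (e / 4) (al / 2).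
have e'0 : 0 < e' by rewrite lt_min !divr_gt0.
have e'e : e' <= e / 4 by rewrite ge_min lexx.
have e'al : e' <= al / 2 by rewrite ge_min lexx orbT.
have [b' [B Bav Bb'] b'al] := sup_adherent e'0 Esup.
rewrite -/al in b'al.
have [Lam IM b'Lam] := mean_of_banach_density Bb'.
pose a := Lam (fun x => (B x)%:R : R); rewrite -/a in b'Lam.
pose f x : R := (B x)%:R - a.
have a01 : 0 <= a <= 1.
  rewrite -[X in X <= a](mean_cst IM) -[X in a <= X](mean_cst IM).
  by apply/andP; split; apply: (mean_le IM); try solve_bounded; move=> x; case: (B x).
have f1 x : `|f x| <= 1.
  by rewrite ler_norml /f; case: (B x) => /=; apply/andP; split; lra.
have fu : uniform_up_to Lam e f.
  have : uniform_up_to Lam (2 * (2 * e')) f.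
    apply: uniform_up_to_of_no_increment => // q q0; rewrite -/a.
    (* A progression of step [q] is a window of one of the [q] rescaled residue
       classes, whence a threshold that does not depend on its start. *)
    have /choice [L0 HL0] : forall r : 'I_q, exists L0, forall L, (L0 <= L)%N ->
        forall x, (window_count (fun m => B (r + q * m)%N) x L)%:R < (al + e') * L%:R.
      move=> r; apply: contrapT => H.
      suff : E (al + e') by move=> /(ub_le_sup (ex_intro _ 1 Eub)); rewrite -/al; lra.
      exists (fun m => B (r + q * m)%N); first exact: avoids_powers_dilate.
      move=> L0; apply: contrapT => H'; apply: H; exists L0 => L L0L x.
      by rewrite ltNge; apply/negP => h; apply: H'; exists L => //; exists x.
    exists (maxn 1 (\max_r L0 r)) => L.
    rewrite geq_max => /andP[L1 /bigmax_leqP L0L] x.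
    have Lpos : 0 < L%:R :> R by rewrite ltr0n.
    have := HL0 (Ordinal (ltn_pmod x q0)) L (L0L _ isT) (x %/ q)%N.
    rewrite /poly_avg ler_pdivrMr// => /ltW h.
    apply: (@le_trans _ _ ((al + e') * L%:R)).
      apply: le_trans h; rewrite /window_count natr_sum; apply: ler_sum => n _ /=.
      rewrite mulnDr addnA [(_ %% _ + _)%N]addnC [(q * (_ %/ _))%N]mulnC.
      by rewrite -divn_eq.
    by rewrite ler_pM2r//; lra.
  move=> H q q0; have [L0 HL0] := H q q0; exists L0 => L /HL0/le_trans; apply.
  lra.
have [d d0 Hd] := Bav.
have dpoly : nat_poly c (fun n => (d * n ^ c)%N).
  exists (fun i => if i == c then d else 0%N); first by rewrite eqxx.
  move=> n; rewrite big_ord_recr /= eqxx big1 ?add0n// => i _.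
  by rewrite ltn_eqF.
have [L0 HL0] := He Lam IM f f1 fu _ dpoly.
have [M HM] := Hd (maxn 1 L0).
have := HL0 _ (leq_maxr 1 L0) M.
set L := maxn 1 L0 in HM *.
have Lpos : 0 < L%:R :> R by rewrite ltr0n leq_maxl.
have -> : Lam (fun x => f x * poly_avg f (fun n => (d * (M + n) ^ c)%N) L x) = - a ^+ 2.
  have -> : (fun x => f x * poly_avg f (fun n => (d * (M + n) ^ c)%N) L x) =
     (fun x => L%:R^-1 * \sum_(n < L) f x * f (x + d * (M + n) ^ c)%N).
    by apply/funext => x; rewrite -mulr_sumr /poly_avg mulrA mulrC.
  have bf : bounded_seq f by rewrite /f; solve_bounded.
  rewrite (meanZ IM); last by solve_bounded.
  rewrite (mean_sum IM); last by move=> n; solve_bounded.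
  rewrite (eq_bigr (fun=> - a ^+ 2)).
    by rewrite sumr_const card_ord -[(- _) *+ _]mulr_natl mulKf ?gt_eqF.
  move=> n _; set h := (d * _ ^ c)%N.
  (* Expand, using that [x] and [x + h] are never both in [B]. *)
  have -> : (fun x => f x * f (x + h)%N) =
      (fun x => a ^+ 2 - a * (B x)%:R - a * (B (x + h)%N)%:R).
    apply/funext => x; rewrite /f.
    have : (B x)%:R * (B (x + h)%N)%:R = 0 :> R.
      case: (boolP (B x)) => [Bx|]; last by rewrite mul0r.
      rewrite (negbTE (HM (M + n)%N x _ Bx)) ?mulr0//.
      by rewrite leq_addr ltn_add2l /=.
    by move: (_%:R) (_%:R) => u v uv; rewrite mulrBl !mulrBr uv; ring.
  rewrite !(meanB IM) ?(mean_cst IM) ?(meanZ IM); try by solve_bounded.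
  rewrite (mean_shift IM h (f := fun x => (B x)%:R)); last by solve_bounded.
  by rewrite -/a; ring.
rewrite normrN ger0_norm ?sqr_ge0// => H.
have : al / 2 <= a by lra.
nra.
Qed.

Lemma int_pow_nat (R : realType) (c n : nat) : int_pow (c%:R : R) n = (n ^ c)%N.
Proof. by rewrite /int_pow powR_mulrn// -natrX natrK. Qed.

(** Failure of syndeticity for the finite set of shifts from [1] to [L] yields a
    window of length [L] disjoint from [D], hence from [Delta1] of [S]. *)
Lemma Delta1_syndetic (R : realType) (c : nat) (S D : set nat) (d : R) :
  (0 < c)%N -> S `<=` posnat -> 0 < d -> d <= upper_density R S ->
  Delta1 (c%:R : R) S `<=` D -> syndetic D.
Proof.
move=> c0 Spos d0 dS SD; apply: contrapT => nsyn.
have Sav : avoids_powers c (mem S).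
  exists 1%N => // L; apply: contrapT => HL; apply: nsyn.
  exists (iota 1 L); first by move=> m /=; rewrite mem_iota => /andP[].
  apply/seteqP; split=> [x [m _ []//]|x x0].
  apply: contrapT => Hx; apply: HL; exists x.+1 => n y /andP[xn nL] /set_mem Sy.
  apply/negP => /set_mem Syn; apply: Hx.
  exists (n - x)%N; first by rewrite /= mem_iota; lia.
  split => //=; rewrite addnC subnK; last exact: ltnW.
  apply: SD; split; first by rewrite /posnat /=; lia.
  exists y; split => //; split; first exact: Spos.
  by rewrite /= int_pow_nat -[(n ^ c)%N]mul1n.
apply: (avoids_powers_banach_null (b := d / 2) c0 _ Sav); first by rewrite divr_gt0.
move=> L0; apply: contrapT => H.
suff : upper_density R S <= d / 2 by lra.
apply: upper_density_le; exists L0.+1 => // N /= hN.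
rewrite density_seqE ler_pdivrMr ?ltr0n ?(leq_trans _ hN)// leNgt.
by apply/negP => h; apply: H; exists N; [exact: ltnW | exists 1%N; exact: ltW].
Qed.

Unset Implicit Arguments.

Theorem theorem1p3 (R : realType) (c k : nat) (S_ : 'I_k -> set nat)
    (c_gt0 : (0 < c)%N) (k_gt0 : (0 < k)%N)
    (S_pos : forall i, S_ i `<=` posnat)
    (S_dens : forall i, 0 < upper_density R (S_ i)) :
  let D := \bigcap_(i in [set: 'I_k]) Delta2 (c%:R : R) (S_ i) in
  (exists S : set nat,
      [/\ S `<=` posnat,
          exists2 d : R, has_density S d & 0 < d &
          Delta1 (c%:R : R) S `<=` D])
  /\ syndetic D.
Proof.
move=> D; have [S Spos [[d Sd d0] Sret]] := natural_density_of_returns S_pos S_dens.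
have SD : Delta1 (c%:R : R) S `<=` D.
  move=> n [n0 [x [Sx [x0 Sxn]]]] i _; split => //=.
  rewrite int_pow_nat in Sxn *.
  have := Sret x (x + n ^ c)%N _ Sx Sxn i; rewrite addKn; apply.
  by rewrite -[X in (X < _)%N]addn0 ltn_add2l expn_gt0 n0.
split; first by exists S; split => //; exists d.
by apply: Delta1_syndetic d0 _ SD => //; have [-> _] := Sd.
Qed.
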